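(* Let $\rho$ be an action of a categorical group $\mathbf{G}$ on a category $\mathbf{V}$. Then $\rho$ yields a double category over $\mathbf{V}$ whose morphisms are the elements $(k,f)\in\mathrm{Mor}(\mathbf{G})\times\mathrm{Mor}(\mathbf{V})$, with source and target given by $$s(k,f)=f\qquad\text{and}\qquad t(k,f)=\rho(k)f,$$ where composition of morphisms is given by $$(k',f')\circ(k,f)=(k'k,f)\quad\text{whenever } f'=\rho(k)f,$$ and horizontal composition is given by $$(k_2,f_2)\circ_h(k_1,f_1)=(k_2\circ k_1,\,f_2\circ f_1)$$ whenever the compositions on the right are defined.
   Context: A categorical group $\mathbf{G}$ is a category with a bifunctor $\otimes:\mathbf{G}\times\mathbf{G}\to\mathbf{G}$ (written as juxtaposition) such that $\mathrm{Obj}(\mathbf{G})$ and $\mathrm{Mor}(\mathbf{G})$ are both groups under $\otimes$. Thus in $\mathrm{Mor}(\mathbf{G})$ there is both a group product $k'k$ and a composition $k'\circ k$ (when defined). The identity element of $\mathrm{Obj}(\mathbf{G})$ is $e$, and $1_e$ is the identity element of the group $\mathrm{Mor}(\mathbf{G})$. An action of $\mathbf{G}$ on a category $\mathbf{V}$ is a functor $\rho:\mathbf{G}\times\mathbf{V}\to\mathbf{V}$ such that $\rho(k',\rho(k,f))=\rho(k'k,f)$ and $\rho(1_e,f)=f$ for all $k,k'\in\mathrm{Mor}(\mathbf{G})$ and $f\in\mathrm{Mor}(\mathbf{V})$. One writes $\rho(k)f$ for $\rho(k,f)$. A double category $\mathbf{C}_{(2)}$ over a category $\mathbf{C}$ is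 a category such that: (a) $\mathrm{Obj}(\mathbf{C}_{(2)})=\mathrm{Mor}(\mathbf{C})$; (b) the morphisms of $\mathbf{C}_{(2)}$ are the arrows of a second category $\mathbf{C}_{(2)}^h$; (c) the composition $\circ$ in $\mathbf{C}_{(2)}$ (vertical composition) and the composition $\circ_h$ in $\mathbf{C}_{(2)}^h$ (horizontal composition) satisfy the following, where $s,t$ denote source and target in $\mathbf{C}_{(2)}$ (so $s(F),t(F)\in\mathrm{Mor}(\mathbf{C})$): (h1) $G\circ_hF$ is defined if and only if both composites $s(G)\circ s(F)$ and $t(G)\circ t(F)$ are defined in $\mathrm{Mor}(\mathbf{C})$, and then $s(G\circ_hF)=s(G)\circ s(F)$ and $t(G\circ_hF)=t(G)\circ t(F)$; (h2) the exchange law $(G'\circ G)\circ_h(F'\circ F)=(G'\circ_hF')\circ(G\circ_hF)$ holds for all morphisms $F:f\to f'$, $F':f'\to f''$, $G:g\to g'$, $G':g'\to g''$ of $\mathbf{C}_{(2)}$ for which $g\circ f$, $g'\circ f'$ and $g''\circ f''$ are defined in $\mathbf{C}$.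
   Formalization: As stated the claim fails unless ρ is free on objects: (h1) can force undefined composites. Proved: (h1) without the ''if'' half of definedness, and (h2) when both horizontal composites on its right side exist; the full double category holds iff ρ(a)v=ρ(b)v implies a=b. *)

(* Defs.v *)
From HB Require Import structures.
From mathcomp Require Import all_boot.

Set Implicit Arguments.
Unset Strict Implicit.
Unset Printing Implicit Defensive.

Local Open Scope group_scope.

(* Categories are presented with one type of objects and one type of morphisms,
   since the morphisms of one category have to serve as objects of another and
   as morphisms of a third.  The partial composition [compm C g f], read "g
   after f", is [None] exactly when the composite is not defined. *)
Record category (O M : Type) : Type := Category {
  src : M -> O;
  tgt : M -> O;
  idm : O -> M;
  compm : M -> M -> option M;
  comp_defined : forall g f, compm g f <-> tgt f = src g;
  src_comp : forall g f h, compm g f = Some h -> src h = src f;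
  tgt_comp : forall g f h, compm g f = Some h -> tgt h = tgt g;
  src_idm : forall a, src (idm a) = a;
  tgt_idm : forall a, tgt (idm a) = a;
  comp_idl : forall f, compm (idm (tgt f)) f = Some f;
  comp_idr : forall f, compm f (idm (src f)) = Some f;
  comp_assoc : forall h g f hg gf, compm h g = Some hg -> compm g f = Some gf ->
    compm hg f = compm h gf
}.

Record is_functor (O M O' M' : Type) (C : category O M) (D : category O' M')
    (Fo : O -> O') (Fm : M -> M') : Prop := IsFunctor {
  functor_src : forall f, src D (Fm f) = Fo (src C f);
  functor_tgt : forall f, tgt D (Fm f) = Fo (tgt C f);
  functor_idm : forall a, Fm (idm C a) = idm D (Fo a);
  functor_comp : forall g f h, compm C g f = Some h ->
    compm D (Fm g) (Fm f) = Some (Fm h)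
}.

Definition opair (A B : Type) (x : option A) (y : option B) : option (A * B) :=
  if x is Some a then omap (pair a) y else None.

Section ProductCategory.
Variables (O M O' M' : Type) (C : category O M) (D : category O' M').

Let psrc (p : M * M') := (src C p.1, src D p.2).
Let ptgt (p : M * M') := (tgt C p.1, tgt D p.2).
Let pidm (a : O * O') := (idm C a.1, idm D a.2).
Let pcomp (q p : M * M') := opair (compm C q.1 p.1) (compm D q.2 p.2).

Lemma pcompP q p r : pcomp q p = Some r ->
  compm C q.1 p.1 = Some r.1 /\ compm D q.2 p.2 = Some r.2.
Proof.
rewrite /pcomp; case: compm => [a|] //=; case: compm => [b|] //=.
by case=> <-.
Qed.

Lemma pcomp_defined q p : pcomp q p <-> ptgt p = psrc q.
Proof.
rewrite /pcomp /ptgt /psrc; split.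
- move: (comp_defined C q.1 p.1) (comp_defined D q.2 p.2).
  case: compm => [a|] //=; case: compm => [b|] //= [h1 _] [h2 _] _.
  by rewrite h1 // h2.
- case=> /(comp_defined C q.1 p.1) + /(comp_defined D q.2 p.2).
  by case: compm => [a|] //=; case: compm.
Qed.

Lemma pcomp_src q p r : pcomp q p = Some r -> psrc r = psrc p.
Proof. by case/pcompP => h1 h2; rewrite /psrc (src_comp h1) (src_comp h2). Qed.

Lemma pcomp_tgt q p r : pcomp q p = Some r -> ptgt r = ptgt q.
Proof. by case/pcompP => h1 h2; rewrite /ptgt (tgt_comp h1) (tgt_comp h2). Qed.

Lemma pidm_src a : psrc (pidm a) = a.
Proof. by case: a => a b; rewrite /psrc /= !src_idm. Qed.

Lemma pidm_tgt a : ptgt (pidm a) = a.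
Proof. by case: a => a b; rewrite /ptgt /= !tgt_idm. Qed.

Lemma pcomp_idl p : pcomp (pidm (ptgt p)) p = Some p.
Proof. by case: p => f g; rewrite /pcomp /= !comp_idl. Qed.

Lemma pcomp_idr p : pcomp p (pidm (psrc p)) = Some p.
Proof. by case: p => f g; rewrite /pcomp /= !comp_idr. Qed.

Lemma pcomp_assoc r q p rq qp : pcomp r q = Some rq -> pcomp q p = Some qp ->
  pcomp rq p = pcomp r qp.
Proof.
case/pcompP => h1 h2; case/pcompP => h3 h4.
by rewrite /pcomp (comp_assoc h1 h3) (comp_assoc h2 h4).
Qed.

Definition prod_category : category (O * O') (M * M') :=
  Category pcomp_defined pcomp_src pcomp_tgt pidm_src pidm_tgt
    pcomp_idl pcomp_idr pcomp_assoc.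

End ProductCategory.

Definition categorical_group (OG MG : groupType) (G : category OG MG) : Prop :=
  is_functor (prod_category G G) G
    (fun p : OG * OG => p.1 * p.2) (fun p : MG * MG => p.1 * p.2).

Record action (OG MG : groupType) (G : category OG MG)
    (OV MV : Type) (V : category OV MV) : Type := Action {
  act_obj : OG -> OV -> OV;
  act : MG -> MV -> MV;
  act_functor : is_functor (prod_category G V) V
    (fun p => act_obj p.1 p.2) (fun p => act p.1 p.2);
  actM : forall k' k f, act k' (act k f) = act (k' * k) f;
  act1 : forall f, act (idm G 1) f = f
}.

Definition ocomp (O M : Type) (C : category O M) (x y : option M) : option M :=
  obind (fun g => obind (compm C g) y) x.

Section DoubleCategory.
(* [vert] is the category C_(2), whose objects are the morphisms of [C], and
   [horz] is C_(2)^h, with the same morphisms as [vert]. *)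
Variables (O M : Type) (C : category O M) (M2 Oh : Type).
Variables (vert : category M M2) (horz : category Oh M2).

Definition base_composable (G F : M2) : Prop :=
  compm C (src vert G) (src vert F) /\ compm C (tgt vert G) (tgt vert F).

Definition horz_boundary : Prop :=
  forall G F H, compm horz G F = Some H ->
    compm C (src vert G) (src vert F) = Some (src vert H) /\
    compm C (tgt vert G) (tgt vert F) = Some (tgt vert H).

(* Both sides of the exchange law are defined, and they are equal. *)
Definition exchange (G' G F' F : M2) : Prop :=
  exists H,
    ocomp horz (compm vert G' G) (compm vert F' F) = Some H /\
    ocomp vert (compm horz G' F') (compm horz G F) = Some H.

Record double_category : Prop := DoubleCategory {
  horz_defined : forall G F, compm horz G F <-> base_composable G F;
  double_boundary : horz_boundary;
  double_exchange : forall F F' G G',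
    tgt vert F = src vert F' -> tgt vert G = src vert G' ->
    compm C (src vert G) (src vert F) ->
    compm C (tgt vert G) (tgt vert F) ->
    compm C (tgt vert G') (tgt vert F') ->
    exchange G' G F' F
}.

(* Here the boundary of a horizontal composite is still that of a double
   category, but composability of the sources and of the targets no longer
   forces the horizontal composite to exist; the exchange law is then required
   whenever the two horizontal composites on its right-hand side exist. *)
Record partial_double_category : Prop := PartialDoubleCategory {
  partial_boundary : horz_boundary;
  partial_exchange : forall F F' G G',
    tgt vert F = src vert F' -> tgt vert G = src vert G' ->
    compm horz G F -> compm horz G' F' ->
    exchange G' G F' F
}.

End DoubleCategory.

(* For the structure determined by an action, [horz_defined] amounts to this.
   It is not automatic: when [V] has a single morphism, every horizontal
   composite would have to exist, whereas [k2] after [k1] need not exist in a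
   categorical group with two distinct objects. *)
Definition free_on_objects (OG MG : groupType) (G : category OG MG)
    (OV MV : Type) (V : category OV MV) (rho : action G V) : Prop :=
  forall a b v, act_obj rho a v = act_obj rho b v -> a = b.

(* Main.v *)
Require Import Defs.
From HB Require Import structures.
From mathcomp Require Import all_boot.
From Stdlib Require Import ClassicalEpsilon.

Set Implicit Arguments.
Unset Strict Implicit.
Unset Printing Implicit Defensive.

Local Open Scope group_scope.

(** The two compositions on [MG * MV] have familiar descriptions.  Vertically
    one gets the action groupoid of the group [MG] on the set [MV]; the only
    point that uses the categorical structure of [G] is that the unit of [MG]
    acts trivially, because the unit law of an action is stated for the identity
    arrow of the unit object, and bifunctoriality of the tensor product makes
    this arrow the unit of [MG] ([idm_unit]).  Horizontally one gets the product
    category of [G] and [V].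

    The compatibility of the two is functoriality read twice.  That the target
    of a horizontal composite is the composite of the targets says that the
    action preserves composition ([action_comp]).  The exchange law compares
    a composite of products with a product of composites in [MG], which is
    the interchange law of the tensor product ([tensor_comp]); its right-hand
    side is vertically composable by [action_comp] again.

    Horizontal composites exist as soon as those of the sources and targets do
    exactly when the action is free on objects: composability of the sources
    gives an object [v], composability of the targets equates the translates
    of [v] by the target of [k1] and by the source of [k2], and every pair of
    objects with equal translates of [v] arises in this way from identities. *)

Section ActionGroupoid.
Variables (OG MG : groupType) (G : category OG MG).
Hypothesis hG : categorical_group G.
Variables (OV MV : Type) (V : category OV MV) (rho : action G V).

(** The identity arrow of the unit object is idempotent for the group law,
    since the tensor product preserves identities. *)
Lemma idm_unit : idm G 1 = 1 :> MG.
Proof.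
have := functor_idm hG (1, 1); rewrite /= mulg1 => idem.
by apply: (@mulgI _ (idm G 1)); rewrite mulg1.
Qed.

Lemma act_one f : act rho 1 f = f.
Proof. by rewrite -idm_unit act1. Qed.

Lemma tensor_comp k2' k1' k' k2 k1 k :
  compm G k2' k1' = Some k' -> compm G k2 k1 = Some k ->
  compm G (k2' * k2) (k1' * k1) = Some (k' * k).
Proof.
move=> def_k' def_k.
apply: (functor_comp hG (g := (k2', k2)) (f := (k1', k1)) (h := (k', k))).
by rewrite /= def_k' def_k.
Qed.

Lemma action_comp k2 k1 k f2 f1 f :
  compm G k2 k1 = Some k -> compm V f2 f1 = Some f ->
  compm V (act rho k2 f2) (act rho k1 f1) = Some (act rho k f).
Proof.
move=> def_k def_f.
apply: (functor_comp (act_functor rho)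
  (g := (k2, f2)) (f := (k1, f1)) (h := (k, f))).
by rewrite /= def_k def_f.
Qed.

Let vsrc (p : MG * MV) := p.2.
Let vtgt (p : MG * MV) := act rho p.1 p.2.
Let vidm (f : MV) : MG * MV := (1, f).

(** Arrows of [V] form a bare type, so equality of a target with a source is
    decided classically. *)
Definition vcomp (q p : MG * MV) : option (MG * MV) :=
  if excluded_middle_informative (vtgt p = vsrc q)
  then Some (q.1 * p.1, p.2) else None.

Lemma vcompE q p : vtgt p = vsrc q -> vcomp q p = Some (q.1 * p.1, p.2).
Proof. by rewrite /vcomp; case: excluded_middle_informative. Qed.

Lemma vcompP q p r :
  vcomp q p = Some r -> vtgt p = vsrc q /\ r = (q.1 * p.1, p.2).
Proof.
by rewrite /vcomp; case: excluded_middle_informative => // ? [<-].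
Qed.

Lemma vcomp_defined q p : vcomp q p <-> vtgt p = vsrc q.
Proof.
split; last by move/vcompE->.
by case def_r: (vcomp q p) => [r|] // _; case/vcompP: def_r.
Qed.

Lemma vcomp_src q p r : vcomp q p = Some r -> vsrc r = vsrc p.
Proof. by case/vcompP => _ ->. Qed.

Lemma vcomp_tgt q p r : vcomp q p = Some r -> vtgt r = vtgt q.
Proof.
by case/vcompP => pq ->; rewrite /vtgt /= -actM -/(vtgt p) pq.
Qed.

Lemma vidm_src f : vsrc (vidm f) = f.
Proof. by []. Qed.

Lemma vidm_tgt f : vtgt (vidm f) = f.
Proof. exact: act_one. Qed.

Lemma vcomp_idl p : vcomp (vidm (vtgt p)) p = Some p.
Proof. by rewrite vcompE // mul1g; case: p. Qed.

Lemma vcomp_idr p : vcomp p (vidm (vsrc p)) = Some p.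
Proof. by rewrite vcompE ?vidm_tgt // mulg1; case: p. Qed.

Lemma vcomp_assoc r q p rq qp :
  vcomp r q = Some rq -> vcomp q p = Some qp -> vcomp rq p = vcomp r qp.
Proof.
move=> def_rq def_qp; have tgt_qp := vcomp_tgt def_qp.
case/vcompP: def_rq => qr def_rq; case/vcompP: def_qp => pq def_qp.
rewrite !vcompE ?tgt_qp ?def_rq //.
by rewrite def_qp /= mulgA.
Qed.

Definition action_groupoid : category MV (MG * MV) :=
  Category vcomp_defined vcomp_src vcomp_tgt
    vidm_src vidm_tgt vcomp_idl vcomp_idr vcomp_assoc.

Lemma action_boundary :
  horz_boundary V action_groupoid (prod_category G V).
Proof.
move=> q p r /pcompP[def_k def_f].
by split; [exact: def_f | exact: action_comp].
Qed.

(** Both sides of the exchange law are the product of the horizontal composites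
    in [MG], paired with the composite of the sources. *)
Lemma action_exchange F F' H H' :
  tgt action_groupoid F = src action_groupoid F' ->
  tgt action_groupoid H = src action_groupoid H' ->
  compm (prod_category G V) H F -> compm (prod_category G V) H' F' ->
  exchange action_groupoid (prod_category G V) H' H F' F.
Proof.
move=> FF' HH'.
case def_HF: compm => [HF|] // _; case def_HF': compm => [HF'|] // _.
case/pcompP: (def_HF) => def_k def_f; case/pcompP: (def_HF') => def_k' def_f'.
exists (HF'.1 * HF.1, HF.2); split.
- rewrite /= !vcompE //=.
  by rewrite (tensor_comp def_k' def_k) def_f.
- rewrite def_HF def_HF' /=; apply: vcompE.
  have := action_comp def_k def_f.
  move: FF' HH'; rewrite /= /vtgt /vsrc => -> ->.
  by rewrite def_f' => -[].
Qed.

Lemma action_partial_double_category :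
  partial_double_category V action_groupoid (prod_category G V).
Proof. by split; [exact: action_boundary | exact: action_exchange]. Qed.

Lemma free_on_objects_comp k2 k1 f2 f1 : free_on_objects rho ->
  compm V f2 f1 -> compm V (act rho k2 f2) (act rho k1 f1) -> compm G k2 k1.
Proof.
move=> free /comp_defined ef /comp_defined et; apply/comp_defined.
have := functor_tgt (act_functor rho) (k1, f1).
have := functor_src (act_functor rho) (k2, f2).
rewrite /= -et ef => -> eq_translates.
exact/esym/(free _ _ _ eq_translates).
Qed.

Lemma action_horz_defined : free_on_objects rho ->
  forall q p, compm (prod_category G V) q p <->
    base_composable V action_groupoid q p.
Proof.
move=> free q p; split.
- by case def_r: compm => [r|] // _;
    case: (action_boundary def_r) => es et; split; rewrite ?es ?et.
- case=> def_s def_t; move: (free_on_objects_comp free def_s def_t) (def_s).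
  by rewrite /= /vsrc; case: compm => [k|] //= _; case: compm.
Qed.

(** For the direct implication, the identities of two objects with equal
    translates of [v], paired with the identity of [v], have composable sources
    and targets, so the two objects coincide once horizontal composites exist. *)
Lemma action_double_categoryP :
  double_category V action_groupoid (prod_category G V) <->
  free_on_objects rho.
Proof.
split=> [dbl a b v eq_translates | free].
- have act_idm c : act rho (idm G c) (idm V v) = idm V (act_obj rho c v).
    exact: (functor_idm (act_functor rho) (c, v)).
  have : compm (prod_category G V) (idm G b, idm V v) (idm G a, idm V v).
    apply/(horz_defined dbl); split; apply/comp_defined.
    + by rewrite /= src_idm tgt_idm.
    + by rewrite /= /vtgt /= !act_idm src_idm tgt_idm.
  by move/comp_defined; rewrite /= !src_idm !tgt_idm => -[].
- split; [exact: action_horz_defined | exact: action_boundary |].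
  move=> F F' H H' FF' HH' def0 def1 def2.
  apply: action_exchange => //; apply/action_horz_defined => //; split=> //.
  by rewrite -FF' -HH'.
Qed.

End ActionGroupoid.

Theorem proposition3p1 (OG MG : groupType) (G : category OG MG)
    (hG : categorical_group G)
    (OV MV : Type) (V : category OV MV) (rho : action G V) :
  exists (Oh : Type)
         (vert : category MV (MG * MV)) (horz : category Oh (MG * MV)),
    [/\ forall (k : MG) (f : MV),
          src vert (k, f) = f /\ tgt vert (k, f) = act rho k f,
        forall (k' : MG) (f' : MV) (k : MG) (f : MV), f' = act rho k f ->
          compm vert (k', f') (k, f) = Some (k' * k, f),
        forall (k2 : MG) (f2 : MV) (k1 : MG) (f1 : MV),
          compm horz (k2, f2) (k1, f1) = opair (compm G k2 k1) (compm V f2 f1),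
        partial_double_category V vert horz
      & double_category V vert horz <-> free_on_objects rho].
Proof.
exists (OG * OV)%type, (action_groupoid hG rho), (prod_category G V).
split=> //.
- by move=> k' f' k f def_f'; exact: vcompE.
- exact: action_partial_double_category.
- exact: action_double_categoryP.
Qed.
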